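(* Suppose $T\in\mathcal{A}_{\infty\to1}^{(n)}(\mathbb{R})$ is an extreme contraction (an extreme point of $\mathcal{A}_{\infty\to1}^{(n)}(\mathbb{R})$) of rank $r$. Then $T$ attains its norm at no fewer than $r^2+r$ extreme points of the closed unit ball $(\ell_\infty^n)_1$ of $\ell_\infty^n(\mathbb{R})$; that is, there are at least $r^2+r$ vectors $w\in\{-1,1\}^n$ with $\|Tw\|_1=\|T\|_{\infty\to1}$.
   Context: $\mathcal{A}_{\infty\to1}^{(n)}(\mathbb{R})=\{T\in M_n(\mathbb{R}):T\ge0,\ \|T\|_{\infty\to1}\le1\}$, where $T\ge0$ means symmetric non-negative definite and $\|T\|_{\infty\to1}$ is the operator norm of $T:\ell_\infty^n(\mathbb{R})\to\ell_1^n(\mathbb{R})$ with respect to the canonical basis. The extreme points of $(\ell_\infty^n)_1$ are the vectors in $\{-1,1\}^n$. *)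

(* Defs.v *)
From HB Require Import structures.
From mathcomp Require Import all_boot all_order all_algebra.
From mathcomp Require Import all_classical all_reals all_analysis.
Import numFieldNormedType.Exports.

Set Implicit Arguments.
Unset Strict Implicit.
Unset Printing Implicit Defensive.

Import Order.TTheory GRing.Theory Num.Theory.

Local Open Scope classical_set_scope.
Local Open Scope ring_scope.

Definition extreme_point (R : realType) (V : lmodType R) (A : set V) (x : V) : Prop :=
  A x /\
  forall (y z : V) (t : R), A y -> A z -> 0 < t -> t < 1 ->
    x = t *: y + (1 - t) *: z -> y = x /\ z = x.

(* The library norm of a matrix is the maximum of the absolute values of its
   entries, so on column vectors it is the norm of ell_infty^n. *)
Definition linf_unit_ball (R : realType) (n : nat) : set 'cV[R]_n :=
  [set x | `|x| <= 1].

Definition l1_norm (R : realType) (n : nat) (x : 'cV[R]_n) : R :=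
  \sum_(i < n) `|x i 0|.

(* The set is nonempty and bounded, so this real-valued [sup] is a genuine
   supremum, not the default value. *)
Definition norm_infty_1 (R : realType) (n : nat) (T : 'M[R]_n) : R :=
  sup [set l1_norm (T *m x) | x in @linf_unit_ball R n].

Definition nonneg_definite (R : realType) (n : nat) (T : 'M[R]_n) : Prop :=
  T^T = T /\ forall x : 'cV[R]_n, 0 <= (x^T *m T *m x) 0 0.

Definition A_infty_1 (R : realType) (n : nat) : set 'M[R]_n :=
  [set T | nonneg_definite T /\ norm_infty_1 T <= 1].

Definition attains_norm_at (R : realType) (n : nat) (T : 'M[R]_n)
    (w : 'cV[R]_n) : Prop :=
  l1_norm (T *m w) = norm_infty_1 T.

Definition sign_vector (R : realType) (n : nat) (w : 'cV[R]_n) : Prop :=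
  forall i : 'I_n, w i 0 = 1 \/ w i 0 = -1.

(* Main.v *)
Require Import Defs.
From HB Require Import structures.
From mathcomp Require Import all_boot all_order all_algebra.
From mathcomp Require Import all_classical all_reals all_analysis.
From mathcomp Require Import ring lra zify.
Import numFieldNormedType.Exports.
Import Order.TTheory GRing.Theory Num.Theory.
Local Open Scope classical_set_scope.
Local Open Scope card_scope.
Local Open Scope ring_scope.

(** Call a sign vector [w] a contact vector if [w^T T w = 1]; since
[w^T T w <= |Tw|_1 <= 1], the norm is attained there. Factor [T = C B] through
its rank [r], and let [Q] be a symmetric [r x r] matrix whose quadratic form
vanishes at every [B w] with [w] contact. Then [D = B^T Q B] has the form
[T X T], so by Cauchy-Schwarz its quadratic form is dominated by that of [T] and
[T +- e D] stays positive for small [e]; its norm stays at most [1] because only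
the finitely many sign vectors matter. Extremality forces [D = 0], hence [Q = 0].
As the equations on [Q] at [w] and [-w] coincide, there must be at least
[r (r + 1) / 2] contact vectors up to sign. *)

Set Implicit Arguments.
Unset Strict Implicit.
Unset Printing Implicit Defensive.

(** * Bilinear forms of square matrices *)

Definition bform (R : comRingType) (n : nat) (T : 'M[R]_n) (x y : 'cV[R]_n) : R :=
  (x^T *m T *m y) 0 0.

(** Sign vectors are indexed by a finite type, [true] standing for [-1], so that they can be counted
    and ranged over in finite sums. *)
Definition sign_col (R : realType) (n : nat) (f : {ffun 'I_n -> bool}) : 'cV[R]_n :=
  \col_i (-1) ^+ f i.

Section BilinearForm.
Variables (R : comRingType) (n : nat).
Implicit Types (T : 'M[R]_n) (x y z : 'cV[R]_n) (a : R).

Lemma bformDl T x y z : bform T (x + y) z = bform T x z + bform T y z.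
Proof. by rewrite /bform linearD /= !mulmxDl mxE. Qed.

Lemma bformDr T x y z : bform T z (x + y) = bform T z x + bform T z y.
Proof. by rewrite /bform mulmxDr mxE. Qed.

Lemma bformZl T a x y : bform T (a *: x) y = a * bform T x y.
Proof. by rewrite /bform linearZ /= -!scalemxAl mxE. Qed.

Lemma bformZr T a x y : bform T x (a *: y) = a * bform T x y.
Proof. by rewrite /bform -scalemxAr mxE. Qed.

Lemma bformDm T1 T2 x y : bform (T1 + T2) x y = bform T1 x y + bform T2 x y.
Proof. by rewrite /bform mulmxDr mulmxDl mxE. Qed.

Lemma bformZm a T x y : bform (a *: T) x y = a * bform T x y.
Proof. by rewrite /bform -scalemxAr -scalemxAl mxE. Qed.

Lemma bformC T x y : T^T = T -> bform T x y = bform T y x.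
Proof.
move=> sT; rewrite /bform.
have -> : y^T *m T *m x = (x^T *m T *m y)^T by rewrite !trmx_mul trmxK sT mulmxA.
by rewrite [RHS]mxE.
Qed.

Lemma bformE T x y : bform T x y = \sum_i x i 0 * (T *m y) i 0.
Proof. by rewrite /bform -mulmxA mxE; apply: eq_bigr => i _; rewrite mxE. Qed.

Lemma bform_delta T i x : bform T (delta_mx i 0) x = (T *m x) i 0.
Proof.
rewrite bformE (bigD1 i) //= big1 ?addr0; last first.
  by move=> j ji; rewrite mxE (negbTE ji) mul0r.
by rewrite mxE !eqxx mul1r.
Qed.

Lemma bform_conj m (Q : 'M[R]_m) (B : 'M[R]_(m, n)) x y :
  bform (B^T *m Q *m B) x y = bform Q (B *m x) (B *m y).
Proof. by rewrite /bform trmx_mul !mulmxA. Qed.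

End BilinearForm.

(** * Cauchy-Schwarz and domination for non-negative definite forms *)

Section PositiveForm.
Variables (R : realType) (n : nat) (T : 'M[R]_n).
Hypothesis psdT : nonneg_definite T.

Lemma bform_ge0 x : 0 <= bform T x x. Proof. exact: psdT.2. Qed.

Lemma bform_amgm x y : bform T x y *+ 2 <= bform T x x + bform T y y.
Proof.
have := bform_ge0 (x + (-1) *: y).
rewrite !(bformDl, bformDr, bformZl, bformZr) (bformC y x psdT.1); lra.
Qed.

Lemma bform_cauchy x y : bform T x y ^+ 2 <= bform T x x * bform T y y.
Proof.
have q0 a b : 0 <= a ^+ 2 * bform T x x + 2 * a * b * bform T x y + b ^+ 2 * bform T y y.
  have := bform_ge0 (a *: x + b *: y).
  rewrite !(bformDl, bformDr, bformZl, bformZr) (bformC y x psdT.1); lra.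
have := bform_ge0 y; rewrite le_eqVlt => /predU1P[y0|y0].
  rewrite -y0 mulr0; have [->|b0] := eqVneq (bform T x y) 0; first by rewrite expr0n.
  (* With [bform T y y = 0] the quadratic is affine in [b]; this [b] brings it to [-1],
     contradicting [q0]. *)
  have := q0 1 (- (bform T x x + 1) / (2 * bform T x y)).
  rewrite -y0.
  have -> : 1 ^+ 2 * bform T x x + 2 * 1 * (- (bform T x x + 1) / (2 * bform T x y))
    * bform T x y + (- (bform T x x + 1) / (2 * bform T x y)) ^+ 2 * 0 = -1.
    by field.
  lra.
rewrite -subr_ge0 -(pmulr_rge0 _ y0).
(* At these coefficients the quadratic equals [bform T y y] times the difference to be shown
   non-negative. *)
have := q0 (bform T y y) (- bform T x y); congr (0 <= _); ring.
Qed.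

(** Cauchy-Schwarz for the pair of the [i]-th basis vector and [x]. *)
Lemma sqr_mulmx_le i x : (T *m x) i 0 ^+ 2 <= T i i * bform T x x.
Proof.
have -> : T i i = bform T (delta_mx i 0) (delta_mx i 0).
  by rewrite bform_delta -colE mxE.
by rewrite -bform_delta; apply: bform_cauchy.
Qed.

(* With [y = T x], [|y_i y_j| <= y_i^2 + y_j^2 <= (T_ii + T_jj) x^T T x]. *)
Lemma psd_dominates (X : 'M[R]_n) :
  exists2 c, 0 <= c & forall x, `|bform (T *m X *m T) x x| <= c * bform T x x.
Proof.
have T0 i : 0 <= T i i.
  have := bform_ge0 (delta_mx i 0); by rewrite bform_delta -colE mxE.
exists (\sum_i \sum_j `|X i j| * (T i i + T j j)).
  by do 2!(apply: sumr_ge0 => ? _); rewrite mulr_ge0 ?addr_ge0.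
move=> x.
have -> : bform (T *m X *m T) x x = \sum_i \sum_j X i j * ((T *m x) i 0 * (T *m x) j 0).
  rewrite -{1}psdT.1 bform_conj bformE; apply: eq_bigr => i _.
  by rewrite [(X *m _) i 0]mxE mulr_sumr; apply: eq_bigr => j _; ring.
rewrite mulr_suml (le_trans (ler_norm_sum _ _ _)) //; apply: ler_sum => i _.
rewrite mulr_suml (le_trans (ler_norm_sum _ _ _)) //; apply: ler_sum => j _.
rewrite normrM -mulrA; apply: ler_wpM2l => //.
have := sqr_mulmx_le i x; have := sqr_mulmx_le j x.
set a := (T *m x) i 0; set b := (T *m x) j 0; rewrite ler_norml => hb ha.
have := sqr_ge0 a; have := sqr_ge0 b.
have := sqr_ge0 (a + b); have := sqr_ge0 (a - b); rewrite sqrrB sqrrD.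
by move=> *; apply/andP; split; lra.
Qed.

End PositiveForm.

(** * The operator norm tested on sign vectors *)

Section InftyOneNorm.
Variables (R : realType) (n : nat).
Implicit Types (T : 'M[R]_n) (x y : 'cV[R]_n).

Lemma l1_norm_sign x : exists f, l1_norm x = \sum_i sign_col R f i 0 * x i 0.
Proof.
exists [ffun i => x i 0 < 0]; apply: eq_bigr => i _.
by rewrite mxE ffunE -normrEsign.
Qed.

Lemma linf_unit_ballP x : linf_unit_ball x <-> forall i, `|x i 0| <= 1.
Proof.
rewrite /linf_unit_ball /= [`|x|]mx_normrE; split => [h i|h].
  by apply: le_trans h; apply: (le_bigmax _ (fun ij : 'I_n * 'I_1 => `|x ij.1 ij.2|) (i, 0)).
by apply: bigmax_le => // -[i j] _ /=; rewrite (ord1 j).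
Qed.

Lemma sign_vector_col f : sign_vector (sign_col R (f : {ffun 'I_n -> bool})).
Proof. by move=> i; rewrite mxE; case: (f i); [right|left]. Qed.

Lemma sign_vector_ball x : sign_vector x -> linf_unit_ball x.
Proof.
by move=> sx; apply/linf_unit_ballP => i; case: (sx i) => ->; rewrite ?normrN normr1.
Qed.

Lemma sum_mul_le_l1 x y : linf_unit_ball x -> \sum_i x i 0 * y i 0 <= l1_norm y.
Proof.
move/linf_unit_ballP => bx; apply: ler_sum => i _.
by rewrite (le_trans (ler_norm _)) // normrM ler_piMl.
Qed.

Lemma norm_infty_1_ub T x : linf_unit_ball x -> l1_norm (T *m x) <= norm_infty_1 T.
Proof.
move=> bx; apply: ub_le_sup; last by exists x.
exists (\sum_i \sum_j `|T i j|) => _ [y /linf_unit_ballP yb <-].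
apply: ler_sum => i _; rewrite mxE (le_trans (ler_norm_sum _ _ _)) //.
by apply: ler_sum => j _; rewrite normrM ler_piMr.
Qed.

(* Duality and the symmetry of [T] let one replace first the output and then
   the input by sign vectors; [bform_amgm] then makes the two coincide. *)
Lemma norm_infty_1_le1 T : nonneg_definite T ->
  (forall f, bform T (sign_col R f) (sign_col R f) <= 1) -> norm_infty_1 T <= 1.
Proof.
move=> psdT h; apply: ge_sup.
  by exists (l1_norm (T *m 0)), 0 => //; apply/linf_unit_ballP => i; rewrite mxE normr0.
move=> _ [x xb <-]; have [f ->] := l1_norm_sign (T *m x).
rewrite -bformE (bformC _ _ psdT.1) bformE.
apply: le_trans (sum_mul_le_l1 _ xb) _.
have [g ->] := l1_norm_sign (T *m sign_col R f).
rewrite -bformE; have := bform_amgm psdT (sign_col R g) (sign_col R f).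
have := h f; have := h g; lra.
Qed.

(** Each coordinate is an endpoint of [[-1, 1]], and a proper convex combination of points of that
    interval reaches an endpoint only if both points are that endpoint. *)
Lemma sign_vector_extreme x : sign_vector x -> extreme_point (@linf_unit_ball R n) x.
Proof.
move=> sx; split; first exact: sign_vector_ball.
move=> y z t /linf_unit_ballP yb /linf_unit_ballP zb t0 t1 xyz.
have e i : y i 0 = x i 0 /\ z i 0 = x i 0.
  have := congr1 (fun v : 'cV[R]_n => v i 0) xyz; rewrite /= !mxE.
  have := yb i; have := zb i; rewrite !ler_norml => /andP[z1 z2] /andP[y1 y2].
  by case: (sx i) => -> h; split; nra.
by split; apply/colP => i; case: (e i).
Qed.

(** For [w] the sign vector of [f], the chain [1 = w^T T w <= |Tw|_1 <= norm_infty_1 T <= 1]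
    collapses to equalities. *)
Lemma attains_norm_sign T f : norm_infty_1 T <= 1 ->
  bform T (sign_col R f) (sign_col R f) = 1 -> attains_norm_at T (sign_col R f).
Proof.
move=> T1 Tf; have bf := sign_vector_ball (sign_vector_col f).
apply/eqP; rewrite eq_le norm_infty_1_ub //= (le_trans T1) // -Tf bformE.
exact: sum_mul_le_l1.
Qed.

Lemma bform_sign_le1 T f : norm_infty_1 T <= 1 -> bform T (sign_col R f) (sign_col R f) <= 1.
Proof.
move=> T1; have bf := sign_vector_ball (sign_vector_col f).
rewrite bformE (le_trans (sum_mul_le_l1 _ bf)) // (le_trans _ T1) //.
exact: norm_infty_1_ub.
Qed.

End InftyOneNorm.

(** * Symmetric matrices isotropic at few given vectors *)

(** There are more unknowns than equations: [A] lists the values of the functionals on the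
    elementary matrices, and its rank is too small for its left kernel to be trivial. *)
Lemma exists_common_zero (F : fieldType) (I : finType) (p q : nat)
    (phi : I -> 'M[F]_(p, q) -> F) :
    (forall i, scalar (phi i)) -> (#|I| < p * q)%N ->
  exists2 Q, Q != 0 & forall i, phi i Q = 0.
Proof.
move=> lin_phi ltI.
pose A := \matrix_(k < p * q, j < #|I|) phi (enum_val j) (vec_mx (delta_mx 0 k)).
have : kermx A != 0.
  by rewrite kermx_eq0 /row_free neq_ltn (leq_ltn_trans (rank_leq_col A)).
case/rowV0Pn => v /sub_kermxP vA v0; exists (vec_mx v); first by rewrite vec_mx_eq0.
move=> i; have phi0 : phi i 0 = 0.
  by have := lin_phi i (-1) 0 0; rewrite scaler0 addr0 mulN1r addNr.
have phi_sum (s : seq 'I_(p * q)) :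
    phi i (\sum_(k <- s) v 0 k *: vec_mx (delta_mx 0 k)) =
    \sum_(k <- s) v 0 k * phi i (vec_mx (delta_mx 0 k)).
  by elim: s => [|k s IH]; rewrite ?big_nil // !big_cons lin_phi IH.
have := congr1 (fun w : 'rV[F]_#|I| => w 0 (enum_rank i)) vA.
rewrite !mxE => <-.
rewrite {1}(row_sum_delta v) linear_sum /=.
under eq_bigr do rewrite linearZ /=.
rewrite phi_sum; apply: eq_bigr => k _; by rewrite mxE enum_rankK.
Qed.

Lemma card_lower_pairs (r : nat) : #|{: {i : 'I_r & 'I_i}}| = 'C(r, 2).
Proof.
rewrite card_tagged sumnE big_map big_enum -bin2_sum big_mkord.
by apply: eq_bigr => i _; rewrite card_ord.
Qed.

(** Consecutive triangular numbers add up to a square: of the [r * r] entries, ['C(r, 2)] symmetry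
    equations leave ['C(r.+1, 2)] free. *)
Lemma binS2D (r : nat) : ('C(r.+1, 2) + 'C(r, 2) = r * r)%N.
Proof. by elim: r => // r IH; have := binS r.+1 1; have := binS r 1; rewrite !bin1; lia. Qed.

(* Symmetry of [Q] is imposed as the ['C(r, 2)] equations [Q i j = Q j i], [j < i],
   on the [r * r] free entries. *)
Lemma exists_sym_isotropic (F : fieldType) (J : finType) (r : nat) (u : J -> 'cV[F]_r) :
    (#|J| < 'C(r.+1, 2))%N ->
  exists Q : 'M[F]_r, [/\ Q != 0, Q^T = Q & forall j, bform Q (u j) (u j) = 0].
Proof.
move=> ltJ.
pose lo (a : {i : 'I_r & 'I_i}) : 'I_r := widen_ord (ltnW (ltn_ord (tag a))) (tagged a).
pose phi (a : J + {i : 'I_r & 'I_i}) (Q : 'M[F]_r) : F :=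
  match a with inl j => bform Q (u j) (u j) | inr a => Q (tag a) (lo a) - Q (lo a) (tag a) end.
have lin_phi a : scalar (phi a).
  case: a => a k Q1 Q2 /=; first by rewrite bformDm bformZm.
  by rewrite !mxE; ring.
have ltI : (#|{: J + {i : 'I_r & 'I_i}}| < r * r)%N.
  by rewrite card_sum card_lower_pairs -binS2D ltn_add2r.
have [Q Q0 Qphi] := exists_common_zero lin_phi ltI.
exists Q; split => // [|j]; last exact: (Qphi (inl j)).
have Qlt (i j : 'I_r) : (j < i)%N -> Q i j = Q j i.
  move=> ji; have /eqP := Qphi (inr (Tagged (fun i : 'I_r => 'I_i) (Ordinal ji))).
  rewrite subr_eq0 => /eqP /=; rewrite /lo /=.
  by have -> : widen_ord (ltnW (ltn_ord i)) (Ordinal ji) = j by apply: val_inj.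
apply/matrixP => i j; rewrite mxE; case: (ltngtP i j) => [/Qlt|/Qlt|/val_inj ->] //.
Qed.

(** * Small perturbations that stay in the set of contractions *)

Lemma exists_uniform_scale (R : realType) (I : finType) (a b : I -> R) :
    (forall i, 0 < a i) -> (forall i, 0 <= b i) ->
  exists2 e, 0 < e & forall i, e * b i <= a i.
Proof.
move=> a0 b0; pose S := \sum_i b i / a i.
have S0 : 0 <= S by apply: sumr_ge0 => i _; rewrite divr_ge0 // ltW.
have S1 : 0 < 1 + S by rewrite ltr_pwDl.
(* Each ratio [b i / a i] is at most [S]; the added [1] keeps the denominator positive even when
   [S = 0]. *)
exists (1 + S)^-1; first by rewrite invr_gt0.
move=> i; rewrite mulrC ler_pdivrMr // mulrC -ler_pdivrMr //.
rewrite /S (bigD1 i) //= addrCA lerDl addr_ge0 //.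
by apply: sumr_ge0 => j _; rewrite divr_ge0 // ltW.
Qed.

Section Perturbation.
Variables (R : realType) (n : nat) (T D : 'M[R]_n) (c : R).
Hypotheses (AT : A_infty_1 T) (symD : D^T = D) (c0 : 0 <= c).
Hypothesis leD : forall x, `|bform D x x| <= c * bform T x x.
Hypothesis D0 : forall f, bform T (sign_col R f) (sign_col R f) = 1 ->
  bform D (sign_col R f) (sign_col R f) = 0.

Lemma perturb_A_infty_1 :
  exists2 e, 0 < e & A_infty_1 (T + e *: D) /\ A_infty_1 (T - e *: D).
Proof.
have [psdT T1] := AT.
pose q (S : 'M[R]_n) f := bform S (sign_col R f) (sign_col R f).
have q1 f : q T f <= 1 by exact: bform_sign_le1.
(* At contact vectors the slack [1 - q T f] is [0], so [1] stands in to keep [a] positive; there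
   [D0] gives the bound instead. *)
pose a f := if q T f == 1 then 1 else 1 - q T f.
have a0 f : 0 < a f.
  rewrite /a; case: eqP => // /eqP qf; by rewrite subr_gt0 lt_neqAle qf q1.
have [e1 e10 he1] := exists_uniform_scale a0 (fun f => normr_ge0 (q D f)).
have c1 : 0 < 1 + c by rewrite ltr_pwDl.
(* The bound [e1] controls the norm through the sign vectors, and [(1 + c)^-1] gives [e * c <= 1],
   which preserves positivity. *)
pose e := Num.min e1 (1 + c)^-1.
have e0 : 0 < e by rewrite lt_min e10 invr_gt0.
have ec : e * c <= 1.
  have : e <= (1 + c)^-1 by rewrite ge_min lexx orbT.
  rewrite -[_^-1]div1r ler_pdivlMr // mulrDr mulr1 => h; lra.
have eq f : e * `|q D f| <= 1 - q T f.
  have [qf|qf] := eqVneq (q T f) 1; first by rewrite /(q D f) D0 // normr0 mulr0 qf subrr.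
  have := he1 f; rewrite /a (negbTE qf); apply: le_trans.
  by rewrite ler_wpM2r // ge_min lexx.
suff main s : `|s| = e -> A_infty_1 (T + s *: D).
  exists e => //; split; first by apply: main; rewrite gtr0_norm.
  by rewrite -scaleNr; apply: main; rewrite normrN gtr0_norm.
move=> se; have psdS : nonneg_definite (T + s *: D).
  split; first by rewrite linearD linearZ /= symD psdT.1.
  move=> x; rewrite -/(bform _ x x) bformDm bformZm.
  have : `|s * bform D x x| <= bform T x x.
    rewrite normrM se (le_trans (ler_wpM2l (ltW e0) (leD x))) // mulrA.
    by rewrite ler_piMl //; apply: psdT.2.
  rewrite ler_norml => /andP[+ _]; lra.
split=> //; apply: norm_infty_1_le1 => // f; rewrite bformDm bformZm.
have := eq f; rewrite -se -normrM ler_norml /q => /andP[_]; lra.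
Qed.

End Perturbation.

(** [x] is the midpoint of [x + d] and [x - d]. *)
Lemma extreme_perturb_eq0 (R : realType) (V : lmodType R) (A : set V) (x d : V) :
  extreme_point A x -> A (x + d) -> A (x - d) -> d = 0.
Proof.
move=> [_ ext] Ap Am.
have [] := ext _ _ 2^-1 Ap Am; [by rewrite invr_gt0|by rewrite invf_lt1 ?ltr1n| |].
  have -> : 1 - 2^-1 = 2^-1 :> R by lra.
  rewrite -scalerDr addrACA subrr addr0 -mulr2n -(scaler_nat 2 x) scalerA mulVf ?scale1r //.
by move/(congr1 (fun y => y - x)); rewrite addrAC subrr add0r.
Qed.

(** * Contact vectors of an extreme contraction and their number *)

Section Extreme.
Variables (R : realType) (n : nat) (T : 'M[R]_n).

Definition contact_set : {set {ffun 'I_n -> bool}} :=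
  [set f | bform T (sign_col R f) (sign_col R f) == 1].

Lemma isotropic_extreme_eq0 (Q : 'M[R]_(\rank T)) :
    extreme_point (@A_infty_1 R n) T -> Q^T = Q ->
    (forall f, f \in contact_set ->
       bform Q (row_base T *m sign_col R f) (row_base T *m sign_col R f) = 0) ->
  Q = 0.
Proof.
move=> extT symQ Q0; have [[psdT T1] _] := extT.
have [L LC] : exists L, L *m col_base T = 1%:M.
  by exists (pinvmx (col_base T)); apply: mulVpmx; exact: col_base_full.
have [V BV] : exists V, row_base T *m V = 1%:M.
  by exists (pinvmx (row_base T)); apply: mulmxVp; exact: row_base_free.
move: (col_base T) (row_base T) (mulmx_base T) LC BV Q0 => C B CB LC BV Q0.
pose D := B^T *m Q *m B.
(* Symmetry gives [T = B^T C^T] for the left factor, while [T = C B] is used for the right one;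
   [L C = 1] then cancels [C] on both sides. *)
have DT : T *m (L^T *m Q *m L) *m T = D.
  transitivity (B^T *m C^T *m (L^T *m Q *m L) *m (C *m B)).
    by rewrite -trmx_mul CB psdT.1.
  rewrite !mulmxA -(mulmxA B^T) -trmx_mul LC trmx1 mulmx1.
  by rewrite -(mulmxA _ L C) LC mulmx1.
have [c c0 leD] := psd_dominates psdT (L^T *m Q *m L).
rewrite DT in leD.
have symD : D^T = D by rewrite /D !trmx_mul trmxK symQ mulmxA.
have [f /eqP Tf|e e0 [Ap Am]] := perturb_A_infty_1 extT.1 symD c0 leD.
  by rewrite bform_conj Q0 // inE.
have /eqP := extreme_perturb_eq0 extT Ap Am.
rewrite scaler_eq0 (gt_eqF e0) /= => /eqP D0.
(* Since [B V = 1], this product is [Q] itself. *)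
have : V^T *m D *m V = 0 by rewrite D0 mulmx0 mul0mx.
by rewrite /D !mulmxA -trmx_mul BV trmx1 mul1mx -mulmxA BV mulmx1.
Qed.

Definition flip (f : {ffun 'I_n -> bool}) : {ffun 'I_n -> bool} := [ffun i => ~~ f i].

Lemma flipK : involutive flip.
Proof. by move=> f; apply/ffunP => i; rewrite !ffunE negbK. Qed.

Lemma sign_col_flip f : sign_col R (flip f) = - sign_col R f.
Proof. by apply/colP => i; rewrite !mxE ffunE signrN. Qed.

Lemma flip_contact f : (flip f \in contact_set) = (f \in contact_set).
Proof. by rewrite !inE sign_col_flip -scaleN1r bformZl bformZr !mulN1r opprK. Qed.

(** Negation [w -> -w] preserves contact and exchanges the two possible signs at coordinate [i], so
    each sign accounts for half of the contact vectors. *)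
Lemma card_contact_half (i : 'I_n) :
  #|contact_set| = (#|[set f in contact_set | f i]|).*2.
Proof.
rewrite -(cardsID [set f : {ffun 'I_n -> bool} | f i] contact_set) -addnn.
congr (_ + _)%N; first by congr #|pred_of_set _|; apply/setP => f; rewrite !inE.
rewrite -(card_imset _ (inv_inj flipK)); congr #|pred_of_set _|; apply/setP => f.
rewrite inE; apply/imsetP/andP => [[g gC ->]|[fC fi]].
  by move: gC; rewrite flip_contact ffunE finset.in_setD inE => /andP[].
by exists (flip f); rewrite ?flipK // finset.in_setD flip_contact fC inE ffunE fi.
Qed.

Lemma card_contact_ge : extreme_point (@A_infty_1 R n) T ->
  (\rank T ^ 2 + \rank T <= #|contact_set|)%N.
Proof.
move=> extT; have [->//|r0] := posnP (\rank T).
(* Positive rank forces [n > 0], which provides a coordinate for choosing one vector of each pair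
   [w], [-w]. *)
pose i : 'I_n := Ordinal (leq_trans r0 (rank_leq_col T)).
set H := [set f in contact_set | f i].
rewrite (card_contact_half i) -/H leqNgt; apply/negP => ltH.
have ltJ : (#|{: {f | f \in H}}| < 'C((\rank T).+1, 2))%N.
  rewrite card_sig -[#|_|]/(#|H|).
  have := binS2D (\rank T); rewrite binS bin1 -mul2n -mulnn in ltH *; lia.
have [Q [/eqP Qn0 symQ Qu]] :=
  exists_sym_isotropic (fun j : {f | f \in H} => row_base T *m sign_col R (val j)) ltJ.
apply: Qn0; apply: isotropic_extreme_eq0 => // f fC.
have QH g : g \in H -> bform Q (row_base T *m sign_col R g) (row_base T *m sign_col R g) = 0.
  by move=> gH; exact: (Qu (exist _ g gH)).
have [fi|/negP fi] := boolP (f i); first by apply: QH; rewrite inE fC.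
(* Here [flip f] is the representative in [H], and a quadratic form agrees at opposite vectors. *)
have := QH (flip f); rewrite sign_col_flip mulmxN -scaleN1r bformZl bformZr !mulN1r opprK.
by apply; rewrite inE flip_contact fC ffunE; apply/negP.
Qed.

End Extreme.

(** * From finite counting to cardinality of sets of vectors *)

Lemma sign_col_inj (R : realType) (n : nat) : injective (@sign_col R n).
Proof.
move=> f g /colP fg; apply/ffunP => i; have := fg i; rewrite !mxE.
by case: (f i) (g i) => [] [] //; rewrite expr0 expr1 => ?; exfalso; lra.
Qed.

Lemma card_le_finset (I : finType) (U : Type) (h : I -> U) (H : {set I}) (A : set U) k :
    injective h -> (k <= #|H|)%N -> (forall f, f \in H -> A (h f)) ->
  `I_k #<= A.
Proof.
(* The case [k = 0] is split off because [nth] needs a default element, taken from [H] when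
   [k > 0]. *)
move=> h_inj kH hA; have [->|k0] := posnP k; first by rewrite II0 card_ge0.
have [f0 _] := card_gt0P (leq_trans k0 kH).
pose e j := h (nth f0 (enum H) j).
have e_in j : j \in `I_k -> (j < size (enum H))%N.
  by rewrite inE /= -cardE => /leq_trans; apply.
have inj_e : {in `I_k &, injective e}.
  move=> j l /e_in jH /e_in lH /h_inj /eqP.
  by rewrite nth_uniq ?enum_uniq // => /eqP.
have /card_eqPle[_ le_e] := inj_card_eq inj_e.
apply: card_le_trans le_e _; apply: subset_card_le => _ [j jk <-].
by apply: hA; rewrite -mem_enum mem_nth // e_in // inE.
Qed.

Theorem theorem2p21 (R : realType) (n r : nat) (T : 'M[R]_n)
    (hT : extreme_point (@A_infty_1 R n) T) (hr : \rank T = r) :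
  `I_(r ^ 2 + r)%N #<=
    [set w : 'cV[R]_n |
      extreme_point (@linf_unit_ball R n) w /\ attains_norm_at T w] /\
  `I_(r ^ 2 + r)%N #<=
    [set w : 'cV[R]_n | sign_vector w /\ attains_norm_at T w].
Proof.
have le_r := card_contact_ge hT; rewrite hr in le_r.
have att f : f \in contact_set T -> attains_norm_at T (sign_col R f).
  by rewrite inE => /eqP; apply: attains_norm_sign; exact: hT.1.2.
split; apply: (card_le_finset (@sign_col_inj R n) le_r) => f fC; split; try exact: att.
- by apply: sign_vector_extreme; exact: sign_vector_col.
- exact: sign_vector_col.
Qed.
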